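(* Let $r$ be continuous, let $f$ be a nontrivial real solution of $f''(x)+r(x)f(x)=0$, let $z_{f'_1}<z_{f'_2}$ be two consecutive zeros of $f'$, let $\mathcal{I}=(z_{f'_1},z_{f'_2})$, and let $z_{f_1}$ be the unique zero of $f$ in $\mathcal{I}$. Put $h=f/f'$ on $\mathcal I$. Suppose $r$ is positive, monotone and differentiable on $\mathcal I$, and let $k_1,k_2$ be positive constants such that $r(x)>k_2$ and $|r'(x)|<k_1$ for all $x\in\mathcal I$, and $\frac{k_2^3}{k_1^2}>\frac16$. Then for every initial guess $x_0\in\mathcal I$ the sequence of Halley's method $$x_{n+1}=x_n-\frac{2h(x_n)}{2+r(x_n)h^2(x_n)},\qquad n=0,1,2,\dots$$ is well defined and converges monotonically to $z_{f_1}$.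
   Context: All functions are real-valued; $r$ is continuous on an open interval $D\subseteq\mathbb{R}$ containing all points mentioned, and $f$ is a not identically zero solution on $D$ of $f''+rf=0$. It is a standing assumption that $f$ has exactly one zero $z_{f_1}$ in $\mathcal I=(z_{f'_1},z_{f'_2})$. Since $f'$ has no zeros in $\mathcal I$, the function $h=f/f'$ is defined on $\mathcal I$. ''Monotone'' for $r$ means non-increasing on $\mathcal I$ or non-decreasing on $\mathcal I$. ''Converges monotonically'' means that the sequence is (weakly) monotone and converges; if $x_0=z_{f_1}$ the sequence is constant. *)

(* Defs.v *)
From Stdlib Require Import Reals.
From Coquelicot Require Import Coquelicot.
Open Scope R_scope.

(* The endpoints may be infinite. *)
Definition Rbar_open_interval (a b : Rbar) (x : R) : Prop :=
  Rbar_lt a (Finite x) /\ Rbar_lt (Finite x) b.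

(* [Derive] is total, hence the explicit differentiability requirements. *)
Definition is_solution (D : R -> Prop) (r f : R -> R) : Prop :=
  forall x, D x ->
    ex_derive f x /\ ex_derive_n f 2 x /\ Derive_n f 2 x + r x * f x = 0.

Definition consecutive_zeros (g : R -> R) (a b : R) : Prop :=
  a < b /\ g a = 0 /\ g b = 0 /\ forall x, open_interval a b x -> g x <> 0.

Definition unique_zero_in (I : R -> Prop) (g : R -> R) (z : R) : Prop :=
  I z /\ g z = 0 /\ forall y, I y -> g y = 0 -> y = z.

Definition monotone_on (I : R -> Prop) (g : R -> R) : Prop :=
  (forall x y, I x -> I y -> x <= y -> g x <= g y) \/
  (forall x y, I x -> I y -> x <= y -> g y <= g x).

Definition ratio (f : R -> R) (x : R) : R := f x / Derive f x.

Definition halley_denom (r h : R -> R) (x : R) : R := 2 + r x * h x ^ 2.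

Fixpoint halley_seq (r h : R -> R) (x0 : R) (n : nat) : R :=
  match n with
  | O => x0
  | S m => let x := halley_seq r h x0 m in
           x - 2 * h x / halley_denom r h x
  end.

(* [halley_seq] is total because real division is; the genuine recursion makes
   sense when every iterate stays in the interval [I] on which [h] is defined
   and no step divides by zero. *)
Definition halley_well_defined (I : R -> Prop) (r h : R -> R) (x0 : R) : Prop :=
  forall n, I (halley_seq r h x0 n) /\
            halley_denom r h (halley_seq r h x0 n) <> 0.

(* When [x 0 = l], weak monotonicity and the limit force [x] to be constant. *)
Definition converges_monotonically (x : nat -> R) (l : R) : Prop :=
  ((forall n, x n <= x (S n)) \/ (forall n, x (S n) <= x n)) /\
  is_lim_seq x l.

(* Main.v *)
(** The ratio [h = f / f'] satisfies the Riccati equation [h' = 1 + r h^2], so it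
    increases through its zero [z], and the Halley map
    [G x = x - 2 h / (2 + r h^2)] has derivative
    [h^2 (3 r^2 h^2 + 2 r' h + 2 r) / (2 + r h^2)^2].  As a quadratic in [h], the
    second factor has discriminant [4 (r'^2 - 6 r^3)], which is negative because
    [k1^2 < 6 k2^3].  Hence [G] is nondecreasing with unique fixed point [z] and
    moves every point towards [z] without overshooting. *)

Require Import Defs.
From Stdlib Require Import Reals Lra.
From Coquelicot Require Import Coquelicot.
Open Scope R_scope.

(** Monotone convergence gives a limit in [[z, u 0]], continuity makes that limit a fixed point of
    [G], and [z] is the only candidate. Everything is required on [[z, u 0]] alone, since [G] will
    be controlled only on a bounded interval. *)
Lemma iterates_decrease_to_fixpoint (G : R -> R) (u : nat -> R) (z : R)
  (u_rec : forall n, u (S n) = G (u n))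
  (u0_ge : z <= u O)
  (G_between : forall x, z <= x <= u O -> z <= G x <= x)
  (G_cont : forall x, z <= x <= u O -> continuous G x)
  (G_fix : forall x, z <= x <= u O -> G x = x -> x = z) :
  (forall n, z <= u n <= u O) /\ (forall n, u (S n) <= u n) /\ is_lim_seq u z.
Proof.
  assert (bounds : forall n, z <= u n <= u O).
  { induction n as [|n IH]; [lra|].
    rewrite u_rec. generalize (G_between _ IH). lra. }
  assert (decr : forall n, u (S n) <= u n).
  { intro n. rewrite u_rec. apply G_between, bounds. }
  split; [exact bounds | split; [exact decr|]].
  destruct (ex_finite_lim_seq_decr u z decr (fun n => proj1 (bounds n))) as [l u_lim].
  assert (l_in : z <= l <= u O).
  { split.
    - apply (is_lim_seq_le (fun _ => z) u z l); auto using is_lim_seq_const.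
      intro n; apply bounds.
    - apply (is_lim_seq_le u (fun _ => u O) l (u O)); auto using is_lim_seq_const.
      intro n; apply bounds. }
  (* The shifted sequence tends to [G l] by continuity and to [l] as a tail of [u]; uniqueness of
     limits equates the two. *)
  assert (shift_lim : is_lim_seq (fun n => u (S n)) (G l)).
  { apply is_lim_seq_ext with (fun n => G (u n)).
    - intro n; symmetry; apply u_rec.
    - apply is_lim_seq_continuous; [|exact u_lim].
      apply continuity_pt_filterlim, G_cont, l_in. }
  apply is_lim_seq_incr_1 in u_lim as shift_lim'.
  assert (l_fix : G l = l).
  { apply is_lim_seq_unique in shift_lim, shift_lim'.
    rewrite shift_lim in shift_lim'. now injection shift_lim'. }
  rewrite <- (G_fix l l_in l_fix). exact u_lim.
Qed.

(** Conjugating [G] by the reflection of the line through 0 reduces this to the decreasing case. *)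
Lemma iterates_increase_to_fixpoint (G : R -> R) (u : nat -> R) (z : R)
  (u_rec : forall n, u (S n) = G (u n))
  (u0_le : u O <= z)
  (G_between : forall x, u O <= x <= z -> x <= G x <= z)
  (G_cont : forall x, u O <= x <= z -> continuous G x)
  (G_fix : forall x, u O <= x <= z -> G x = x -> x = z) :
  (forall n, u O <= u n <= z) /\ (forall n, u n <= u (S n)) /\ is_lim_seq u z.
Proof.
  destruct (iterates_decrease_to_fixpoint
    (fun x => - G (- x)) (fun n => - u n) (- z)) as [bounds [decr lim]].
  - intro n. now rewrite u_rec, Ropp_involutive.
  - lra.
  - intros x x_in. generalize (G_between (- x)). lra.
  - intros x x_in. apply (continuous_opp (fun x => G (- x)) x).
    apply (continuous_comp Ropp G x).
    + apply (continuous_opp (fun x => x) x), continuous_id.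
    + apply G_cont. lra.
  - intros x x_in x_fix. generalize (G_fix (- x)). lra.
  - repeat split.
    + generalize (bounds n). lra.
    + generalize (bounds n). lra.
    + intro n. generalize (decr n). lra.
    + apply is_lim_seq_opp in lim. simpl in lim. rewrite Ropp_involutive in lim.
      apply is_lim_seq_ext with (2 := lim). intro n. apply Ropp_involutive.
Qed.

Definition halley_map (r h : R -> R) (x : R) : R := x - 2 * h x / halley_denom r h x.

Lemma halley_denom_pos (r h : R -> R) (x : R) : 0 < r x -> 0 < halley_denom r h x.
Proof.
  intro r_pos. unfold halley_denom. generalize (pow2_ge_0 (h x)). nra.
Qed.

(** The quotient rule, with the second derivative eliminated by the differential equation; [q]
    stands for the value of the coefficient at the single point [x]. *)
Lemma is_derive_ratio (f : R -> R) (q x : R)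
  (f_diff : ex_derive f x)
  (f'_diff : is_derive (Derive f) x (- q * f x))
  (f'_neq0 : Derive f x <> 0) :
  is_derive (ratio f) x (1 + q * ratio f x ^ 2).
Proof.
  replace (1 + q * ratio f x ^ 2)
    with ((Derive f x * Derive f x - f x * (- q * f x)) / Derive f x ^ 2)
    by (unfold ratio; field; exact f'_neq0).
  apply is_derive_div; [now apply Derive_correct | exact f'_diff | exact f'_neq0].
Qed.

(** Write [d] for the denominator. The Riccati equation reads [h' = d - 1], so the numerator
    [d^2 - 2 h' d + 2 h d'] equals [d (2 - d) + 2 h d']. Both [2 - d = - r h^2] and [h d'] contain
    the factor [h^2]. *)
Lemma is_derive_halley_map (r h : R -> R) (x : R)
  (r_diff : ex_derive r x)
  (h_riccati : is_derive h x (1 + r x * h x ^ 2))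
  (r_pos : 0 < r x) :
  is_derive (halley_map r h) x
    (h x ^ 2 * (3 * r x ^ 2 * h x ^ 2 + 2 * Derive r x * h x + 2 * r x)
     / halley_denom r h x ^ 2).
Proof.
  assert (denom_pos := halley_denom_pos r h x r_pos).
  assert (h_diff : ex_derive h x) by (eexists; exact h_riccati).
  unfold halley_map, halley_denom in *.
  auto_derive.
  - repeat split; auto. lra.
  - change (fun t : R => h t) with h. change (fun t : R => r t) with r.
    rewrite (is_derive_unique h x _ h_riccati). field. lra.
Qed.

Lemma halley_quadratic_nonneg (q p t : R) :
  0 < q -> p ^ 2 < 6 * q ^ 3 -> 0 <= 3 * q ^ 2 * t ^ 2 + 2 * p * t + 2 * q.
Proof.
  intros q_pos disc.
  (* Multiplying by the positive leading coefficient completes the square without division; the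
     remainder is positive by [disc]. *)
  assert (square : 3 * q ^ 2 * (3 * q ^ 2 * t ^ 2 + 2 * p * t + 2 * q)
                   = (3 * q ^ 2 * t + p) ^ 2 + (6 * q ^ 3 - p ^ 2)) by ring.
  assert (0 < 3 * q ^ 2) by nra.
  generalize (pow2_ge_0 (3 * q ^ 2 * t + p)). nra.
Qed.

Lemma nondecreasing_of_derive_nonneg (g g' : R -> R) (x y : R)
  (g_derive : forall t, x <= t <= y -> is_derive g t (g' t))
  (g'_nonneg : forall t, x <= t <= y -> 0 <= g' t) :
  x <= y -> g x <= g y.
Proof.
  intro xy.
  destruct (MVT_gen g x y g') as [c [c_in eq]];
    rewrite Rmin_left, Rmax_right in * by exact xy.
  - intros t t_in. apply g_derive. lra.
  - intros t t_in. apply continuity_pt_filterlim.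
    apply (ex_derive_continuous g). eexists. now apply g_derive.
  - generalize (g'_nonneg c c_in). nra.
Qed.

Theorem theorem3p8 (a b : Rbar) (r f : R -> R) (z1 z2 z k1 k2 : R)
  (r_cont : forall x, Rbar_open_interval a b x -> continuous r x)
  (f_sol : is_solution (Rbar_open_interval a b) r f)
  (f_nontrivial : exists x, Rbar_open_interval a b x /\ f x <> 0)
  (z1_in : Rbar_open_interval a b z1)
  (z2_in : Rbar_open_interval a b z2)
  (z12 : consecutive_zeros (Derive f) z1 z2)
  (z_zero : unique_zero_in (open_interval z1 z2) f z)
  (r_pos : forall x, open_interval z1 z2 x -> 0 < r x)
  (r_mono : monotone_on (open_interval z1 z2) r)
  (r_diff : forall x, open_interval z1 z2 x -> ex_derive r x)
  (k1_pos : 0 < k1)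
  (k2_pos : 0 < k2)
  (r_lower : forall x, open_interval z1 z2 x -> r x > k2)
  (r'_bound : forall x, open_interval z1 z2 x -> Rabs (Derive r x) < k1)
  (k_ineq : k2 ^ 3 / k1 ^ 2 > 1 / 6) :
  forall x0, open_interval z1 z2 x0 ->
    halley_well_defined (open_interval z1 z2) r (ratio f) x0 /\
    converges_monotonically (halley_seq r (ratio f) x0) z.
Proof.
  destruct z12 as [z1_lt_z2 [_ [_ f'_neq0]]].
  destruct z_zero as [z_in [fz z_unique]].
  assert (in_D : forall x, open_interval z1 z2 x -> Rbar_open_interval a b x).
  { intros x [z1x xz2]. split.
    - apply Rbar_lt_trans with z1; [apply z1_in | exact z1x].
    - apply Rbar_lt_trans with z2; [exact xz2 | apply z2_in]. }
  set (h := ratio f). set (G := halley_map r h).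
  assert (h_riccati : forall x, open_interval z1 z2 x ->
            is_derive h x (1 + r x * h x ^ 2)).
  { intros x x_in. destruct (f_sol x (in_D x x_in)) as [f_diff [f'_diff ode]].
    apply is_derive_ratio; [exact f_diff | | now apply f'_neq0].
    replace (- r x * f x) with (Derive (Derive f) x)
      by (change (Derive (Derive f) x) with (Derive_n f 2 x); lra).
    apply Derive_correct. exact f'_diff. }
  assert (hz : h z = 0) by (unfold h, ratio; rewrite fz; apply Rmult_0_l).
  assert (h_zero : forall x, open_interval z1 z2 x -> h x = 0 -> x = z).
  { intros x x_in hx. apply z_unique; [exact x_in|].
    replace (f x) with (h x * Derive f x)
      by (unfold h, ratio; field; now apply f'_neq0).
    rewrite hx. apply Rmult_0_l. }
  assert (h_mono : forall x y, open_interval z1 z2 x -> open_interval z1 z2 y ->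
            x <= y -> h x <= h y).
  { intros x y x_in y_in. unfold open_interval in x_in, y_in.
    apply nondecreasing_of_derive_nonneg with (fun t => 1 + r t * h t ^ 2);
      intros t t_in; assert (t_in_I : open_interval z1 z2 t) by (split; lra).
    - now apply h_riccati.
    - generalize (r_pos t t_in_I) (pow2_ge_0 (h t)). nra. }
  (* The uniform bounds give the pointwise chain [r'^2 <= k1^2 < 6 k2^3 <= 6 r^3]. *)
  assert (disc : forall x, open_interval z1 z2 x -> Derive r x ^ 2 < 6 * r x ^ 3).
  { intros x x_in.
    assert (k12 : k1 ^ 2 < 6 * k2 ^ 3).
    { assert (k1sq : 0 < k1 ^ 2) by now apply pow_lt.
      apply (Rmult_gt_compat_r (k1 ^ 2)) in k_ineq; [|exact k1sq].
      replace (k2 ^ 3 / k1 ^ 2 * k1 ^ 2) with (k2 ^ 3) in k_ineq by (field; lra).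
      lra. }
    assert (k2 ^ 3 <= r x ^ 3).
    { apply pow_incr. generalize (r_lower x x_in). lra. }
    assert (Derive r x ^ 2 <= k1 ^ 2).
    { rewrite <- pow2_abs. apply pow_incr. split; [apply Rabs_pos|].
      now apply Rlt_le, r'_bound. }
    lra. }
  assert (G_derive := fun x x_in => is_derive_halley_map r h x
    (r_diff x x_in) (h_riccati x x_in) (r_pos x x_in)).
  fold G in G_derive.
  assert (G_mono : forall x y, open_interval z1 z2 x -> open_interval z1 z2 y ->
            x <= y -> G x <= G y).
  { intros x y x_in y_in. unfold open_interval in x_in, y_in.
    eapply nondecreasing_of_derive_nonneg;
      intros t t_in; assert (t_in_I : open_interval z1 z2 t) by (split; lra).
    - now apply G_derive.
    - apply Rdiv_le_0_compat.
      + apply Rmult_le_pos; [apply pow2_ge_0|].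
        apply halley_quadratic_nonneg; auto.
      + now apply pow_lt, halley_denom_pos, r_pos. }
  assert (G_cont : forall x, open_interval z1 z2 x -> continuous G x).
  { intros x x_in. apply (ex_derive_continuous G). eexists. now apply G_derive. }
  (* As the denominator is positive, [x - G x] has the sign of [h x]: this fixes the direction of
     each step and identifies the fixed points of [G] with the zeros of [h]. *)
  assert (G_step : forall x, open_interval z1 z2 x ->
            (x - G x) * halley_denom r h x = 2 * h x).
  { intros x x_in. unfold G, halley_map. field.
    apply Rgt_not_eq, halley_denom_pos, r_pos, x_in. }
  assert (Gz : G z = z).
  { unfold G, halley_map. rewrite hz. unfold Rdiv. ring. }
  assert (G_fix : forall x, open_interval z1 z2 x -> G x = x -> x = z).
  { intros x x_in x_fix. apply h_zero; [exact x_in|].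
    generalize (G_step x x_in). rewrite x_fix. lra. }
  intros x0 x0_in.
  (* Positivity of [r] rules out a zero denominator, so only confinement of the iterates to the
     interval remains. *)
  assert (well_def : (forall n, open_interval z1 z2 (halley_seq r h x0 n)) ->
            halley_well_defined (open_interval z1 z2) r h x0).
  { intros seq_in n. split; [apply seq_in|].
    apply Rgt_not_eq, halley_denom_pos, r_pos, seq_in. }
  unfold open_interval in x0_in, z_in.
  destruct (Rle_lt_dec z x0) as [zx0 | x0z].
  - assert (in_I : forall x, z <= x <= x0 -> open_interval z1 z2 x)
      by (intros; split; lra).
    destruct (iterates_decrease_to_fixpoint G (halley_seq r h x0) z)
      as [bounds [decr lim]]; simpl; auto.
    + intros x x_in. split.
      (* No overshoot: [z = G z <= G x]. *)
      * rewrite <- Gz. apply G_mono; auto; lra.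
      (* Right of [z] one has [h x >= h z = 0], so the step goes to the left. *)
      * assert (hx : h z <= h x) by (apply h_mono; auto; lra).
        generalize (G_step x (in_I x x_in))
          (halley_denom_pos r h x (r_pos x (in_I x x_in))). nra.
    + split; [|split; auto].
      apply well_def. intro n. apply in_I, bounds.
  - assert (in_I : forall x, x0 <= x <= z -> open_interval z1 z2 x)
      by (intros; split; lra).
    destruct (iterates_increase_to_fixpoint G (halley_seq r h x0) z)
      as [bounds [incr lim]]; simpl; auto; [lra | |].
    + intros x x_in. split.
      (* Left of [z] the sign of [h] is reversed, and the step goes to the right. *)
      * assert (hx : h x <= h z) by (apply h_mono; auto; lra).
        generalize (G_step x (in_I x x_in))
          (halley_denom_pos r h x (r_pos x (in_I x x_in))). nra.
      * rewrite <- Gz. apply G_mono; auto; lra.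
    + split; [|split; auto].
      apply well_def. intro n. apply in_I, bounds.
Qed.
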